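(* Let $X$ be a countable discrete Abelian group, let $F$ be the $2$-component of $X$ (the subgroup of all elements whose order is a power of $2$), and let $G$ be the subgroup generated by all elements of odd order of $X$. Let $\alpha$ be an automorphism of $X$ satisfying the condition $\mathrm{Ker}(I+\alpha)=\{0\}$. Let $\xi_1$ and $\xi_2$ be independent random variables with values in $X$ and distributions $\mu_1$ and $\mu_2$. If the conditional distribution of the linear form $L_2=\xi_1+\alpha\xi_2$ given $L_1=\xi_1+\xi_2$ is symmetric, then there exist probability distributions $\rho_1,\rho_2$ on $X$ with $\sigma(\rho_j)\subset F$, a finite subgroup $K$ of $G$, and elements $x_1,x_2\in X$ such that $\mu_j=\rho_j*m_K*E_{x_j}$, $j=1,2$.
   Context: $I$ denotes the identity automorphism of a group. $\sigma(\rho)$ denotes the support of a distribution $\rho$. The conditional distribution of $L_2$ given $L_1$ is symmetric if the conditional distributions of $L_2$ given $L_1$ and of $-L_2$ given $L_1$ coincide, equivalently the random pairs $(L_1,L_2)$ and $(L_1,-L_2)$ are identically distributed. $m_K$ denotes the Haar distribution (normalized Haar measure) of a compact subgroup $K$, regarded as a distribution on $X$; $E_x$ is the degenerate distribution concentrated at $x$; $*$ is convolution of probability distributions. *)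

(* Defs.v *)
From HB Require Import structures.
From mathcomp Require Import all_boot all_order all_algebra.
From mathcomp Require Import all_classical all_reals all_analysis.

Set Implicit Arguments.
Unset Strict Implicit.
Unset Printing Implicit Defensive.

Import Order.TTheory GRing.Theory Num.Theory.

Local Open Scope classical_set_scope.
Local Open Scope ring_scope.

(* A countable Abelian group seen as a discrete topological group: every set
   is open, so every set is Borel. *)
Definition discrete (X : Type) : Type := X.

HB.instance Definition _ (X : countZmodType) :=
  CountRing.Zmodule.copy (discrete X) X.
HB.instance Definition _ (X : countZmodType) := isPointed.Build (discrete X) 0.
HB.instance Definition _ (X : countZmodType) :=
  hasNbhs.Build (discrete X) principal_filter.
HB.instance Definition _ (X : countZmodType) :=
  Discrete_ofNbhs.Build (discrete X) erefl.
HB.instance Definition _ (X : countZmodType) :=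
  @isMeasurable.Build default_measure_display (discrete X)
    discrete_measurable discrete_measurable0
    discrete_measurableC discrete_measurableU.

Section groups.
Context (X : zmodType).
Implicit Types (x : X) (S H : set X).

Definition has_order x (n : nat) :=
  [/\ (0 < n)%N, x *+ n = 0 & forall m, (0 < m < n)%N -> x *+ m <> 0].

Definition is_subgroup H := zmod_closed [in H].

Definition generated_subgroup S : set X := smallest is_subgroup S.

Definition two_component : set X := [set x | exists k, has_order x (2 ^ k)%N].

Definition odd_subgroup : set X :=
  generated_subgroup [set x | exists2 n, odd n & has_order x n].

End groups.

Arguments two_component : clear implicits.
Arguments odd_subgroup : clear implicits.

Section probability_on_groups.
Context (X : countZmodType) (R : realType).
Local Notation T := (discrete X).
Local Open Scope ereal_scope.

Definition distr_support (rho : set T -> \bar R) : set T :=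
  [set x | forall U, nbhs x U -> 0 < rho U].

(* The normalized Haar measure of K, extended by 0 outside K, is the unique
   distribution with these two properties (for K a finite subgroup). *)
Definition is_haar_distribution (K : set T) (m : probability T R) :=
  m K = 1 /\
  forall k (A : set T), K k -> m [set (k + a)%R | a in A] = m A.

Definition addp (p : T * T) : T := (p.1 + p.2)%R.

Lemma measurable_addp : measurable_fun [set: T * T] addp.
Proof.
move=> _ A _; rewrite setTI.
have -> : addp @^-1` A =
    \bigcup_x ([set x : T] `*` [set y : T | A (x + y)%R]).
  apply/seteqP; split => [[x y] /= Axy|[x y] [_ _ [/= -> //]]].
  by exists x.
apply: countable_bigcupT_measurable; first exact: countableP.
move=> x.
exact: measurableX.
Qed.

HB.instance Definition _ := isMeasurableFun.Build _ _ _ _ addp measurable_addp.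

Definition convolution (mu nu : probability T R) :=
  distribution (mu \x nu) addp.

HB.instance Definition _ (mu nu : probability T R) :=
  Probability.on (convolution mu nu).

End probability_on_groups.

Section random_variables.
Context d (Omega : measurableType d) (R : realType) (P : probability Omega R).
Local Open Scope ereal_scope.

Definition independent_RV d1 d2 (T1 : measurableType d1)
    (T2 : measurableType d2) (Y : {RV P >-> T1}) (Z : {RV P >-> T2}) :=
  forall A B, measurable A -> measurable B ->
    P (Y @^-1` A `&` Z @^-1` B) = P (Y @^-1` A) * P (Z @^-1` B).

Definition conditional_distribution (S T : Type) (Z : Omega -> T)
    (Y : Omega -> S) (y : S) (B : set T) : R :=
  (fine (P (Z @^-1` B `&` Y @^-1` [set y])) / fine (P (Y @^-1` [set y])))%R.

(* Y takes values in a countable discrete space, so its conditioning events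
   are the atoms [Y = y] of positive probability. *)
Definition conditionally_symmetric (S : Type) (X : zmodType)
    (Z : Omega -> X) (Y : Omega -> S) :=
  forall y, 0 < P (Y @^-1` [set y]) ->
    conditional_distribution Z Y y =
    conditional_distribution (fun w => (- Z w)%R) Y y.

End random_variables.

(* Main.v *)
Require Import Defs.
From HB Require Import structures.
From mathcomp Require Import all_boot all_order all_algebra.
From mathcomp Require Import all_classical all_reals all_analysis.
From mathcomp Require Import finmap ring.

(** Put [phi x = x + alpha x]. By hypothesis the pairs (L1, L2) and (L1, -L2)
    have the same law, so substituting -L2 for L2 in the forms
    alpha L1 - L2 and L1 - L2 gives two equalities in law between linear
    images of the independent variables:
      alpha xi1 - xi1 ~ phi xi1 + 2 alpha xi2,
      xi2 - alpha xi2 ~ phi xi2 + 2 xi1.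

    Each has the shape psi xi ~ phi xi + h eta with xi, eta independent and phi
    injective. Compare l2-norms of the mass functions. A linear image merges
    atoms, so the norm of the law of psi xi is at least that of xi, which is
    that of phi xi; adding an independent variable can only lower the norm.
    Hence there is equality in Jensen's inequality ([l2_rigidity]): the law of
    psi xi is the translate of the law of phi xi by h y, for each atom y of eta
    ([convolution_translates]).

    Let D_j be the group generated by differences of atoms of xi_j, and S_j the
    group of periods of its law; S_j is finite because masses add up to 1, and
    it lies in D_j. Comparing translates by two atoms shows that 2 alpha D_2
    lies in phi S_1 and 2 D_1 in phi S_2 ([convolution_periods]), and comparing
    supports shows that (alpha - 1) D_1, hence 2 D_1, lies in phi D_1
    ([convolution_difference_group]). So 2 D_j is killed by some positive
    integer, and D_j is the direct sum of a 2-group and its odd part.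
    On odd parts 2 is invertible and these inclusions go around a circle of
    finite sets, where they become equalities: D_1 and D_2 have the same odd
    part K, and it is contained in S_1 and S_2 ([common_odd_part]).

    Finally let u and v be integers such that multiplication by u and v are the
    projections of D_j to its 2-part and odd part. If x_j is an atom of xi_j,
    then xi_j - x_j is the sum of its u-multiple, in the 2-component, and its
    v-multiple, in K; since the law is K-periodic, the second summand may be
    replaced by an independent uniform element of K ([haar_decomposition]). *)

Set Implicit Arguments.
Unset Strict Implicit.
Unset Printing Implicit Defensive.

Import Order.TTheory GRing.Theory Num.Theory.

Local Open Scope classical_set_scope.
Local Open Scope ring_scope.

(** * Subgroups, orders and finite exponent *)

(** The image has at most as many elements as the set it covers. *)
Lemma finite_sub_image_eq (T : choiceType) (A : set T) (f : T -> T) :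
  finite_set A -> A `<=` f @` A -> f @` A = A.
Proof.
move=> /finite_fsetP[B ->] sAfA.
have BfB : (B `<=` f @` B)%fset.
  apply/fsubsetP => x xB; have [y yB <-] := sAfA x xB.
  by apply/imfsetP; exists y.
have eqB : B = (f @` B)%fset.
  by apply/eqP; rewrite eqEfcard BfB; exact: leq_imfset_card.
apply/seteqP; split => [_ [y yB <-]|//].
by rewrite /= eqB; apply/imfsetP; exists y.
Qed.

Section subgroups.
Context (X : zmodType).
Implicit Types (x y : X) (H S : set X).

Lemma subgroup0 H : is_subgroup H -> H 0.
Proof. by case=> /set_mem. Qed.

Lemma subgroupB H x y : is_subgroup H -> H x -> H y -> H (x - y).
Proof. by case=> _ HB Hx Hy; apply/set_mem/HB; exact/mem_set. Qed.

Lemma subgroupN H x : is_subgroup H -> H x -> H (- x).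
Proof. by move=> sH Hx; rewrite -sub0r; apply: subgroupB (subgroup0 sH) _. Qed.

Lemma subgroupD H x y : is_subgroup H -> H x -> H y -> H (x + y).
Proof.
by move=> sH Hx Hy; rewrite -[y]opprK; apply: subgroupB => //; exact: subgroupN.
Qed.

Lemma subgroupMn H x n : is_subgroup H -> H x -> H (x *+ n).
Proof.
move=> sH Hx; elim: n => [|n IHn]; first exact: subgroup0.
by rewrite mulrS; exact: subgroupD.
Qed.

Lemma is_subgroupP H :
  H 0 -> (forall x y, H x -> H y -> H (x - y)) -> is_subgroup H.
Proof.
move=> H0 HB; split; first exact/mem_set.
by move=> x y /set_mem Hx /set_mem Hy; exact/mem_set/HB.
Qed.

Lemma generated_is_subgroup S : is_subgroup (generated_subgroup S).
Proof.
apply: is_subgroupP => [H [sH _]|x y Sx Sy H HS]; first exact: subgroup0.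
by have [sH _] := HS; exact: (subgroupB sH (Sx _ HS) (Sy _ HS)).
Qed.

Lemma subgroup_image_preimage (Y : zmodType) (phi h : {additive X -> Y}) H :
  is_subgroup H -> is_subgroup [set t | exists2 e, H e & h t = phi e].
Proof.
move=> sH; apply: is_subgroupP => [|s t [e He es] [f Hf ft]].
  by exists 0; [exact: subgroup0|rewrite !raddf0].
by exists (e - f); [exact: subgroupB|rewrite !raddfB es ft].
Qed.

(** Translation by an element of the subgroup permutes its elements, so their
    sum does not change when that element is added to each of them. *)
Lemma finite_subgroup_exponent H : is_subgroup H -> finite_set H ->
  exists2 n, (0 < n)%N & forall x, H x -> x *+ n = 0.
Proof.
move=> sH /finite_fsetP[B HB]; exists #|` B|%N.
  rewrite cardfs_gt0; apply/fset0Pn; exists 0.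
  by have := subgroup0 sH; rewrite HB.
move=> x Hx.
have inB y : (y \in B) <-> H y by rewrite HB.
have shiftB : [fset (x + y)%R | y in B]%fset = B.
  apply/fsetP => z; apply/imfsetP/idP => [[y /= yB ->]|zB].
    by apply/inB; apply: (subgroupD sH Hx); exact/inB.
  exists (z - x); last by rewrite [RHS]addrC subrK.
  by apply/inB; apply: (subgroupB sH _ Hx); exact/inB.
have : \sum_(y <- [fset (x + y)%R | y in B]%fset) y = \sum_(y <- B) y.
  by rewrite shiftB.
rewrite big_imfset /=; last by move=> y z _ _; exact: addrI.
rewrite big_split /= big_const_seq count_predT iter_addr_0.
by move/(congr1 (fun s => s - \sum_(y <- B) y)); rewrite addrK subrr.
Qed.

Lemma mulrn_modn x m n : x *+ n = 0 -> x *+ (m %% n) = x *+ m.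
Proof.
by move=> xn0; rewrite {2}(divn_eq m n) mulrnDr mulnC mulrnA xn0 mul0rn add0r.
Qed.

Lemma has_order_dvd x m : (0 < m)%N -> x *+ m = 0 ->
  exists2 n, (n %| m)%N & has_order x n.
Proof.
move=> m_gt0 xm0.
have ex : exists n, (0 < n)%N && (x *+ n == 0).
  by exists m; rewrite m_gt0 xm0 eqxx.
case: (ex_minnP ex) => n /andP[n_gt0 /eqP xn0] n_min.
have ltn_mod : (m %% n < n)%N by rewrite ltn_mod.
exists n.
  rewrite /dvdn -leqn0 leqNgt; apply/negP => r_gt0.
  have := n_min (m %% n)%N; rewrite r_gt0 /= leqNgt ltn_mod /=.
  by rewrite mulrn_modn // xm0 eqxx => /(_ isT).
split => // k /andP[k_gt0 k_lt] xk0.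
by have := n_min k; rewrite k_gt0 xk0 eqxx leqNgt k_lt => /(_ isT).
Qed.

Lemma two_componentP x k : x *+ 2 ^ k = 0 -> two_component X x.
Proof.
move=> /(has_order_dvd _)[|n]; first by rewrite expn_gt0.
by case/(dvdn_pfactor _ _ (isT : prime 2)) => j _ -> ox; exists j.
Qed.

Lemma odd_subgroupP x b : odd b -> x *+ b = 0 -> odd_subgroup X x.
Proof.
move=> odd_b /(has_order_dvd (odd_gt0 odd_b))[n nb ox] H [_]; apply.
by exists n => //; exact: dvdn_odd nb odd_b.
Qed.

End subgroups.

(** * Odd parts *)

(** By the Chinese remainder theorem; [u] and [v] act as the projections of a
    group of exponent [N] onto its 2-part and its odd part. *)
Lemma two_odd_idempotents N : (0 < N)%N ->
  exists k b u v,
    [/\ odd b, N = (2 ^ k * b)%N, (b %| u)%N, (2 ^ k %| v)%N &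
        u + v = 1 %[mod N]].
Proof.
move=> N_gt0; have [b] := pfactor_coprime (isT : prime 2) N_gt0.
set k := logn 2 N; rewrite coprime2n => odd_b ->.
have co : coprime (2 ^ k) b by apply: coprimeXl; rewrite coprime2n.
exists k, b, (chinese (2 ^ k) b 1 0), (chinese (2 ^ k) b 0 1).
split => //; rewrite ?[(b * _)%N]mulnC //.
- by rewrite /dvdn chinese_modr // mod0n.
- by rewrite /dvdn chinese_modl // mod0n.
apply/eqP; rewrite chinese_remainder //; apply/andP; split.
  by rewrite -modnDm !chinese_modl // modnDm addn0.
by rewrite -modnDm !chinese_modr // modnDm add0n.
Qed.

Section odd_parts.
Context (X : zmodType).
Implicit Types (H S : set X).

Definition torsion_part (b : nat) H : set X := [set x | H x /\ x *+ b = 0].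

Lemma torsion_part_subgroup b H :
  is_subgroup H -> is_subgroup (torsion_part b H).
Proof.
move=> sH; apply: is_subgroupP => [|x y [Hx xb] [Hy yb]].
  by split; [exact: subgroup0|rewrite mul0rn].
by split; [exact: subgroupB|rewrite mulrnBl xb yb subrr].
Qed.

(** In the odd part every element is the double of another one, so a relation
    between doubles becomes a relation between elements; projecting onto the
    odd part removes the 2-torsion of the solution. *)
Lemma odd_part_lift (N k b u v : nat) (S1 S2 : set X)
    (psi phi : {additive X -> X}) :
  (0 < k)%N -> N = (2 ^ k * b)%N -> (b %| u)%N -> (2 ^ k %| v)%N ->
  u + v = 1 %[mod N] ->
  is_subgroup S1 -> is_subgroup S2 -> (forall x, S2 x -> x *+ N = 0) ->
  (forall x, S1 x -> exists2 y, S2 y & psi (x *+ 2) = phi y) ->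
  forall x, torsion_part b S1 x ->
    exists2 y, torsion_part b S2 y & psi x = phi y.
Proof.
move=> k_gt0 NE b_u k_v uv1 sS1 sS2 NS2 lift2 x [S1x xb0].
have xN0 : x *+ N = 0 by rewrite NE mulnC mulrnA xb0 mul0rn.
have xv : x *+ v = x.
  rewrite -[RHS]mulr1n -(mulrn_modn 1 xN0) -uv1 mulrn_modn // mulrnDr.
  by have /dvdnP[s ->] := b_u; rewrite mulnC mulrnA xb0 mul0rn add0r.
have /dvdnP[w vE] : (2 %| v)%N by apply: dvdn_trans k_v; exact: dvdn_exp.
have [|y S2y yE] := lift2 (x *+ w); first exact: subgroupMn.
exists (y *+ v).
  split; first exact: subgroupMn.
  have /dvdnP[t ->] := k_v.
  by rewrite -mulrnA -mulnA -NE mulnC mulrnA NS2 // mul0rn.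
by rewrite raddfMn -yE -mulrnA -vE xv -raddfMn xv.
Qed.

(** Write [O H] for the elements of odd order of [H], and phi = 1 + alpha. The
    hypotheses become inclusions of O H1 into phi (O H1) and phi (O S2), and of
    alpha (O H2) into phi (O S1). A finite set covered by its own image equals
    it; hence phi and alpha permute O H1, which gives O H2 inside O H1, and the
    inclusion of O H1 in phi (O H2) closes the circle. All the inclusions are
    then equalities, in particular those of O S1 and O S2 in the common set. *)
Lemma common_odd_part (alpha : {additive X -> X}) (alpha' : X -> X)
    (H1 H2 S1 S2 : set X) :
  cancel alpha alpha' -> cancel alpha' alpha ->
  (forall x, x + alpha x = 0 -> x = 0) ->
  is_subgroup H1 -> is_subgroup H2 ->
  is_subgroup S1 -> is_subgroup S2 ->
  finite_set S1 -> finite_set S2 ->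
  S1 `<=` H1 -> S2 `<=` H2 ->
  (forall x, H2 x -> exists2 y, S1 y & alpha (x *+ 2) = y + alpha y) ->
  (forall x, H1 x -> exists2 y, S2 y & x *+ 2 = y + alpha y) ->
  (forall x, H1 x -> exists2 y, H1 y & x *+ 2 = y + alpha y) ->
  exists k b u v, [/\ odd b /\ (b %| u)%N,
    (forall x, H1 x \/ H2 x ->
       [/\ x *+ u *+ 2 ^ k = 0, x *+ v *+ b = 0 & x = x *+ u + x *+ v]),
    torsion_part b H1 = torsion_part b H2,
    torsion_part b H1 `<=` S1 & torsion_part b H1 `<=` S2].
Proof.
move=> alphaK alpha'K phi0 sH1 sH2 sS1 sS2 fS1 fS2 SH1 SH2 lift21 lift12 lift11.
pose phi : {additive X -> X} := idfun \+ alpha.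
have phi_inj : injective phi.
  move=> x y; rewrite /phi /= => xy; apply/eqP; rewrite -subr_eq0; apply/eqP.
  by apply: phi0; rewrite raddfB addrACA -opprD xy subrr.
have [n1 n1_gt0 Sn1] := finite_subgroup_exponent sS1 fS1.
have [n2 n2_gt0 Sn2] := finite_subgroup_exponent sS2 fS2.
(* n1 * n2 kills S1 and S2, and doubling sends H1 and H2 into copies of them;
   the factor 2 also makes the projection v onto the odd part even. *)
pose N := (2 * (n1 * n2))%N.
have N_gt0 : (0 < N)%N by rewrite !muln_gt0 n1_gt0.
have S1N x : S1 x -> x *+ (n1 * n2) = 0.
  by move=> /Sn1 x0; rewrite mulrnA x0 mul0rn.
have S2N x : S2 x -> x *+ (n1 * n2) = 0.
  by move=> /Sn2 x0; rewrite mulnC mulrnA x0 mul0rn.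
have H1N x : H1 x -> x *+ N = 0.
  move=> /lift12[y S2y yE]; rewrite /N mulrnA yE.
  by rewrite mulrnDl -raddfMn S2N // raddf0 addr0.
have H2N x : H2 x -> x *+ N = 0.
  move=> /lift21[y S1y yE]; apply: (can_inj alphaK).
  rewrite raddf0 /N mulrnA raddfMn yE.
  by rewrite mulrnDl -raddfMn S1N // raddf0 addr0.
have [k [b [u [v [odd_b NE b_u k_v uv1]]]]] := two_odd_idempotents N_gt0.
have k_gt0 : (0 < k)%N.
  case: k NE {k_v} => // NE; move: odd_b.
  by rewrite -[b]mul1n -[1%N]/(2 ^ 0)%N -NE oddM.
pose O := torsion_part b.
have lift (S S' : set X) (psi psi' : {additive X -> X}) :=
  @odd_part_lift N k b u v S S' psi psi' k_gt0 NE b_u k_v uv1.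
have O11 : O H1 `<=` phi @` O H1.
  move=> x Ox; have [y Oy yE] := lift H1 H1 idfun phi sH1 sH1 H1N lift11 x Ox.
  by exists y.
have O12 : O H1 `<=` phi @` O S2.
  move=> x Ox; have S2N' y : S2 y -> y *+ N = 0 by move=> /SH2/H2N.
  have [y Oy yE] := lift H1 S2 idfun phi sH1 sS2 S2N' lift12 x Ox.
  by exists y.
have O21 x : O H2 x -> exists2 y, O S1 y & alpha x = phi y.
  have S1N' y : S1 y -> y *+ N = 0 by move=> /SH1/H1N.
  exact: (lift H2 S1 alpha phi sH2 sS1 S1N' lift21 x).
have fO1 : finite_set (O H1).
  apply: sub_finite_set O12 _; apply: finite_image.
  by apply: sub_finite_set fS2 => x [].
have OS1 : O S1 `<=` O H1 by move=> x [/SH1 ? ?].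
have OS2 : O S2 `<=` O H2 by move=> x [/SH2 ? ?].
have phiO1 : phi @` O H1 = O H1 by exact: finite_sub_image_eq.
have alphaO1 x : O H1 x -> O H1 (alpha x).
  move=> Ox; have : O H1 (phi x) by rewrite -phiO1; exists x.
  move=> /(subgroupB (torsion_part_subgroup b sH1))/(_ Ox).
  by rewrite addrC addKr.
have alpha'O1 : alpha' @` O H1 = O H1.
  apply: finite_sub_image_eq => // x Ox; exists (alpha x); last exact: alphaK.
  exact: alphaO1.
have O2sub1 : O H2 `<=` O H1.
  move=> x /O21[y /OS1 Oy xE]; rewrite -alpha'O1; exists (alpha x) => //.
  by rewrite xE -phiO1; exists y.
have phiO2 : phi @` O H2 = O H2.
  apply: finite_sub_image_eq; first exact: sub_finite_set fO1.
  by move=> x /O2sub1/O12[y /OS2 Oy <-]; exists y.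
have O12eq : O H1 = O H2.
  by apply/seteqP; split => // x /O12[y /OS2 Oy <-]; rewrite -phiO2; exists y.
exists k, b, u, v; split => //.
- move=> x Hx; have xN : x *+ N = 0 by case: Hx => [/H1N|/H2N].
  split; rewrite -?mulrnA.
  + have /dvdnP[s ->] := b_u.
    by rewrite -mulnA [(b * _)%N]mulnC -NE mulnC mulrnA xN mul0rn.
  + have /dvdnP[s ->] := k_v.
    by rewrite -mulnA -NE mulnC mulrnA xN mul0rn.
  + by rewrite -mulrnDr -(mulrn_modn _ xN) uv1 mulrn_modn.
- move=> x Ox; have : O H2 (alpha' (phi x)).
    rewrite -O12eq -alpha'O1; exists (phi x) => //.
    by rewrite -phiO1; exists x.
  by move=> /O21[y [S1y _]]; rewrite alpha'K => /phi_inj ->.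
- move=> x Ox; have : O H1 (phi x) by rewrite -phiO1; exists x.
  by move=> /O12[y [S2y _] /phi_inj <-].
Qed.

End odd_parts.

(** * Sums over arbitrary index sets and equality in Jensen's inequality *)

Section esum_complements.
Context (R : realType).
Local Open Scope ereal_scope.

Lemma esumZl (T : choiceType) (S : set T) (c : R) (f : T -> \bar R) :
  (0 <= c)%R -> (forall i, 0 <= f i) ->
  \esum_(i in S) (c%:E * f i) = c%:E * \esum_(i in S) f i.
Proof.
move=> c0 f0; rewrite /esum -ereal_supZl //; last first.
  apply/set0P; exists 0, set0; first exact: fsets_set0.
  by rewrite fsbig_set0.
congr ereal_sup; rewrite image_comp; apply: eq_imagel => A [finA AS] /=.
by rewrite /= ge0_mule_fsumr.
Qed.

Lemma esum_exchange (S T : choiceType) (f : S -> T -> \bar R) :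
  (forall i j, 0 <= f i j) ->
  \esum_(i in setT) \esum_(j in setT) f i j =
  \esum_(j in setT) \esum_(i in setT) f i j.
Proof.
move=> f0; rewrite !esum_esum //.
rewrite (@reindex_esum _ _ _ (setT `*`` (fun=> setT)) _ (fun k => (k.2, k.1))).
  by [].
by split => [[x y]//|[x y] [z t] _ _ [-> ->]//|[x y] _]; exists (y, x).
Qed.

Lemma esum_ge_term (T : choiceType) (f : T -> \bar R) x :
  (forall i, 0 <= f i) -> f x <= \esum_(i in setT) f i.
Proof.
move=> f0; rewrite -(@esum_set1 _ _ x f) //.
rewrite [leRHS](esumID [set x]) // setTI leeDl //.
exact: esum_ge0.
Qed.

Lemma esum_shift (X : zmodType) (f : X -> \bar R) c :
  \esum_(x in setT) f (x - c)%R = \esum_(x in setT) f x.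
Proof.
rewrite [RHS](@reindex_esum _ _ _ setT setT (fun x => x - c)%R) //.
by split => [//|x y _ _ /addIr//|x _]; exists (x + c)%R; rewrite ?addrK.
Qed.

(** Jensen's inequality for the square, in the case of equality: the average
    [r] of translates of [a] has no larger l2-norm than [a], because the mean
    of [norm (a(. - h y) - r)^2] is [norm a ^2 - norm r ^2]; if the norm does
    not drop, every translate of positive weight is [r] itself. *)
Lemma l2_rigidity (X : choiceType) (Z : zmodType) (q : X -> R) (a r : Z -> R)
    (h : X -> Z) :
  (forall y, 0 <= q y)%R -> (forall z, 0 <= a z)%R -> (forall z, 0 <= r z)%R ->
  \esum_(y in setT) (q y)%:E = 1 ->
  (forall z, (r z)%:E = \esum_(y in setT) (q y * a (z - h y)%R)%:E) ->
  \esum_(z in setT) (a z ^+ 2)%:E <= \esum_(z in setT) (r z ^+ 2)%:E ->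
  \esum_(z in setT) (r z ^+ 2)%:E < +oo ->
  forall y z, (0 < q y)%R -> a (z - h y)%R = r z.
Proof.
move=> q0 a0 r0 q1 rE; set N := \esum_(z in _) _; set M := \esum_(z in _) _.
move=> NM Moo.
have M0 : 0 <= M by apply: esum_ge0 => z _; rewrite lee_fin sqr_ge0.
have Mfin : M \is a fin_num by rewrite ge0_fin_numE.
have N0 : 0 <= N by apply: esum_ge0 => z _; rewrite lee_fin sqr_ge0.
(* V is the squared distance of a translate to the average, C the scalar
   product of the two. *)
pose V y := \esum_(z in setT) ((a (z - h y)%R - r z) ^+ 2)%:E.
pose C y := \esum_(z in setT) (a (z - h y)%R * r z)%:E.
have V0 y : 0 <= V y by apply: esum_ge0 => z _; rewrite lee_fin sqr_ge0.
have C0 y : 0 <= C y by apply: esum_ge0 => z _; rewrite lee_fin mulr_ge0.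
have VC y : V y + 2%:E * C y = N + M.
  rewrite /N -(esum_shift _ (h y)) -esumZl; last first.
  - by move=> z; rewrite lee_fin mulr_ge0.
  - by [].
  rewrite -!esumD; last 4 first.
  - by move=> z _; rewrite lee_fin sqr_ge0.
  - by move=> z _; rewrite lee_fin sqr_ge0.
  - by move=> z _; rewrite lee_fin sqr_ge0.
  - by move=> z _; rewrite -EFinM lee_fin !mulr_ge0.
  by apply: eq_esum => z _; rewrite -EFinM -!EFinD; congr EFin; ring.
have avg (c : \bar R) : c \is a fin_num -> 0 <= c ->
    \esum_(y in setT) ((q y)%:E * c) = c.
  move=> cfin c0.
  transitivity (\esum_(y in setT) ((fine c)%:E * (q y)%:E)).
    by apply: eq_esum => y _; rewrite muleC fineK.
  rewrite esumZl ?fine_ge0 //.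
  by rewrite q1 mule1 fineK.
have qC : \esum_(y in setT) ((q y)%:E * C y) = M.
  transitivity (\esum_(y in setT) \esum_(z in setT)
      ((r z)%:E * (q y * a (z - h y)%R)%:E)).
    apply: eq_esum => y _; rewrite -esumZl //; last first.
      by move=> z; rewrite lee_fin mulr_ge0.
    by apply: eq_esum => z _; rewrite -!EFinM; congr EFin; ring.
  rewrite esum_exchange; last by move=> y z; rewrite -EFinM lee_fin !mulr_ge0.
  apply: eq_esum => z _; rewrite esumZl //; last first.
    by move=> y; rewrite lee_fin mulr_ge0.
  by rewrite -rE -EFinM.
have qV : \esum_(y in setT) ((q y)%:E * V y) + 2%:E * M = N + M.
  have -> : 2%:E * M = \esum_(y in setT) (2%:E * ((q y)%:E * C y)).
    rewrite esumZl ?qC // => y.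
    by rewrite mule_ge0 // lee_fin.
  have NMfin : N + M \is a fin_num.
    by rewrite fin_numD Mfin ge0_fin_numE // (le_lt_trans NM).
  rewrite -(avg (N + M)) ?adde_ge0 // -esumD; last 2 first.
  - by move=> y _; rewrite mule_ge0 // lee_fin.
  - by move=> y _; rewrite !mule_ge0 // lee_fin.
  apply: eq_esum => y _; rewrite -(VC y) ge0_muleDr // ?mule_ge0 //.
  by rewrite muleCA.
have qV0 : \esum_(y in setT) ((q y)%:E * V y) <= 0.
  rewrite -(leeD2rE _ _ (_ : 2%:E * M \is a fin_num)) ?fin_numM // qV add0e.
  rewrite -[2%R]/(1 + 1)%R EFinD muleDl ?fin_num_adde_defl // mul1e.
  exact: leeD2r.
move=> y z qy; apply/eqP; rewrite -subr_eq0 -sqrf_eq0 eq_le sqr_ge0 andbT.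
rewrite -(pmulr_rle0 _ qy).
have qV1 : (q y)%:E * V y <= 0.
  apply: le_trans qV0; apply: (esum_ge_term (f := fun y => (q y)%:E * V y)).
  by move=> i; rewrite mule_ge0 // lee_fin.
rewrite -lee_fin EFinM; apply: le_trans qV1.
rewrite lee_pmul2l ?lte_fin //.
apply: (esum_ge_term (f := fun z => ((a (z - h y)%R - r z) ^+ 2)%:E)).
by move=> i; rewrite lee_fin sqr_ge0.
Qed.

End esum_complements.

(** * Laws on a countable group: atoms, periods, convolution equations *)

Section discrete_laws.
Context (X : countZmodType) (R : realType).
Local Notation T := (discrete X).
Local Open Scope ereal_scope.

(** The law of total probability over the values of [Y]. *)
Lemma measure_partition d (S : measurableType d)
    (m : {measure set S -> \bar R}) (Y : S -> T) (E : set S) :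
  measurable_fun setT Y -> measurable E ->
  m E = \esum_(y in setT) m (E `&` Y @^-1` [set y]).
Proof.
move=> mY mE.
have mEY (A : set T) : measurable (E `&` Y @^-1` A).
  by apply: measurableI => //; rewrite -[_ @^-1` _]setTI; exact: mY.
pose F n := E `&` Y @^-1` [set y : T | choice.pickle y = n].
transitivity (m (\bigcup_(n in setT) F n)).
  congr (m _); apply/seteqP; split => [w Ew|w [n _ []]//].
  by exists (choice.pickle (Y w)).
rewrite measure_bigcup; first last.
- by move=> i j _ _ [w [[_ /= <-] [_ /= <-]]].
- by move=> i _; exact: mEY.
rewrite nneseries_esum // (esumID (range (@choice.pickle T))) //.
rewrite [X in _ + X]esum1 ?adde0; last first.
  move=> n [_ nP]; rewrite (_ : F n = set0) ?measure0 //.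
  apply/seteqP; split => // w [_ /= Yn]; apply: nP.
  by exists (Y w).
rewrite (@reindex_esum _ T _ setT _ (@choice.pickle T)); last first.
  split => [y _|x y _ _|n [_ [y _ <-]]].
  - by split; [exact/mem_set|exists y].
  - exact: (pcan_inj choice.pickleK).
  - by exists y.
apply: eq_esum => y _; congr (m (_ `&` _)).
by apply/seteqP; split => w /=; [exact: (pcan_inj choice.pickleK)|move=> ->].
Qed.

Lemma law_esum (mu : probability T R) A :
  mu A = \esum_(x in setT) (if x \in A then mu [set x] else 0).
Proof.
rewrite (measure_partition mu (@measurable_id _ T setT)) //.
apply: eq_esum => x _ /=; case: ifPn => [/set_mem Ax|/negP xA].
  by congr (mu _); apply/seteqP; split => [y []//|y /= ->].
rewrite (_ : _ `&` _ = set0) ?measure0 //.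
apply/seteqP; split => // y [Ay /= yx]; apply: xA.
by rewrite -yx; exact/mem_set.
Qed.

(** The change of variables formula for expectations. *)
Lemma esum_image_law (mu : probability T R) (f : T -> T) (g : T -> \bar R) :
  (forall z, 0 <= g z) -> (forall z, g z \is a fin_num) ->
  \esum_(z in setT) (mu (f @^-1` [set z]) * g z) =
  \esum_(x in setT) (mu [set x] * g (f x)).
Proof.
move=> g0 gfin.
transitivity (\esum_(z in setT) \esum_(x in setT)
    (if z \in [set f x] then mu [set x] * g (f x) else 0)).
  apply: eq_esum => z _.
  rewrite law_esum muleC -[g z]fineK // -esumZl ?fine_ge0 //; last first.
    by move=> x; case: ifP.
  apply: eq_esum => x _; rewrite fineK //.
  case: ifPn => [/set_mem /= <-|zfx]; first by rewrite mem_set // muleC.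
  rewrite mule0 ifF //; apply/negP => /set_mem /= zfx'.
  by move/negP: zfx; apply; exact/mem_set.
rewrite esum_exchange; last by move=> z x; case: ifP => // _; rewrite mule_ge0.
by apply: eq_esum => x _; rewrite -esum_mkcond esum_set1 // mule_ge0.
Qed.

Lemma law_esum1 (mu : probability T R) : \esum_(x in setT) mu [set x] = 1.
Proof.
rewrite -(probability_setT mu) [RHS]law_esum.
by apply: eq_esum => x _; rewrite in_setT.
Qed.

Definition translation_period (mu : probability T R) : set T :=
  [set e | forall x, mu [set (x + e)%R] = mu [set x]].

Definition atoms (mu : probability T R) : set T := [set x | 0 < mu [set x]].

Definition difference_group (mu : probability T R) : set T :=
  generated_subgroup [set (s - t)%R | s in atoms mu & t in atoms mu].

Lemma not_atom (mu : probability T R) x : ~ atoms mu x -> mu [set x] = 0.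
Proof.
move=> /negP; rewrite -leNgt => x_le0.
by apply/eqP; rewrite eq_le x_le0 measure_ge0.
Qed.

Lemma atoms_nonempty (mu : probability T R) : exists x, atoms mu x.
Proof.
apply: contrapT => noatom.
suff : \esum_(x in setT) mu [set x] = 0.
  by rewrite law_esum1 => /eqP; rewrite onee_eq0.
by apply: esum1 => x _; apply: not_atom => mu_x; apply: noatom; exists x.
Qed.

Lemma atomsP (mu : probability T R) (A : set T) :
  0 < mu A -> exists2 x, atoms mu x & A x.
Proof.
move=> A_gt0; apply: contrapT => noatom; move: A_gt0.
rewrite law_esum esum1 ?ltxx // => x _.
case: ifPn => // /set_mem Ax.
by apply: not_atom => mu_x; apply: noatom; exists x.
Qed.

Lemma atoms_gt0 (mu : probability T R) (A : set T) x :
  atoms mu x -> A x -> 0 < mu A.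
Proof.
move=> x_gt0 Ax; apply: lt_le_trans x_gt0 _.
apply: le_measure; [exact/mem_set|exact/mem_set|by move=> y /= ->].
Qed.

Lemma translation_period_subgroup (mu : probability T R) :
  is_subgroup (translation_period mu).
Proof.
apply: is_subgroupP => [x|e f pe pf x]; first by rewrite addr0.
by rewrite -(pf (x + (e - f))%R) -addrA subrK pe.
Qed.

(** A periodic law gives every translate of an atom the same mass, and the
    masses add up to 1. *)
Lemma finite_translation_period (mu : probability T R) :
  finite_set (translation_period mu).
Proof.
have [x0 x0_gt0] := atoms_nonempty mu; apply: contrapT => infP.
pose c := fine (mu [set x0]).
have muc : mu [set x0] = c%:E by rewrite fineK // fin_num_measure.
have c_gt0 : (0 < c)%R by rewrite -lte_fin -muc.
have [B BP nB] := infinite_set_fset (Num.bound c^-1) infP.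
suff : (c * #|` B|%:R <= 1)%R.
  apply/negP; rewrite -ltNge mulrC -ltr_pdivrMr // mul1r.
  apply: lt_le_trans (archi_boundP _) _; first by rewrite invr_ge0 ltW.
  by rewrite ler_nat.
rewrite -lee_fin -(law_esum1 mu).
rewrite -(esum_shift _ (- x0)%R); apply: esum_ge.
exists [set` B] => //.
rewrite (eq_fsbigr (fun=> c%:E)); last first.
  by move=> x /set_mem/BP xP; rewrite opprK addrC xP.
rewrite fsbig_finite //= set_fsetK sumEFin big_const_seq count_predT.
by rewrite iter_addr_0 mulr_natr.
Qed.

Lemma translation_period_sub (mu : probability T R) :
  translation_period mu `<=` difference_group mu.
Proof.
move=> e pe H [_ SH]; have [x0 x0_gt0] := atoms_nonempty mu; apply: SH.
exists (x0 + e)%R; first by rewrite /atoms /= pe.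
by exists x0 => //; rewrite addrC addKr.
Qed.

Lemma generated_subgroup_ind (S H : set T) :
  is_subgroup H -> S `<=` H -> generated_subgroup S `<=` H.
Proof. by move=> sH SH x; apply. Qed.

(** The hypothesis on preimages says that psi xi and phi xi + h eta have the
    same law when xi and eta are independent with laws [mu] and [nu]. The l2-norm of
    psi xi is at least that of xi, because the fibres of psi gather mass, and
    that of xi is the norm of phi xi because phi is injective. So averaging the
    translates of the law of phi xi does not lower the norm, and [l2_rigidity]
    applies. *)
Lemma convolution_translates (mu nu : probability T R)
    (phi psi h : {additive T -> T}) :
  injective phi ->
  (forall z, mu (psi @^-1` [set z]) =
     \esum_(y in setT) (nu [set y] * mu [set x | phi x + h y = z]%R)) ->
  forall y z, atoms nu y ->
    mu (phi @^-1` [set z - h y]%R) = mu (psi @^-1` [set z]).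
Proof.
move=> phi_inj lawE y z nu_y.
have fin (m : probability T R) A : m A = (fine (m A))%:E.
  by rewrite fineK // fin_num_measure.
have fin0 (m : probability T R) A : (0 <= fine (m A))%R by rewrite fine_ge0.
rewrite fin [RHS]fin; congr EFin.
pose q y := fine (nu [set y]).
pose a z := fine (mu (phi @^-1` [set z])).
pose r z := fine (mu (psi @^-1` [set z])).
have sqE (f : T -> T) (g := fun z => mu (f @^-1` [set z])) :
    \esum_(z in setT) (fine (g z) ^+ 2)%:E =
    \esum_(x in setT) (mu [set x] * g (f x)).
  rewrite -esum_image_law // => [|t]; last by rewrite fin_num_measure.
  by apply: eq_esum => t _; rewrite expr2 EFinM -fin.
apply: (@l2_rigidity R T T q a r h) => //.
- by move=> t; exact: fin0.
- by move=> t; exact: fin0.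
- by move=> t; exact: fin0.
- by rewrite -(law_esum1 nu); apply: eq_esum => t _; rewrite -fin.
- move=> t; rewrite -fin lawE; apply: eq_esum => s _.
  rewrite EFinM -!fin; congr (_ * mu _).
  by apply/seteqP; split => x /= => [<-|->]; rewrite ?addrK ?subrK.
- rewrite /a /r !sqE; apply: le_esum => x _; apply: lee_wpmul2l => //.
  apply: le_measure; [exact/mem_set|exact/mem_set|by move=> t /= /phi_inj ->].
- apply: (@le_lt_trans _ _ 1); last exact: ltry.
  rewrite sqE -(law_esum1 mu); apply: le_esum => x _.
  by rewrite -[leRHS]mule1; apply: lee_wpmul2l => //; exact: probability_le1.
- by rewrite /q -lte_fin -fin.
Qed.

(** Translates by [h y] and [h y'] agree, so [h (y - y')] is a period of the law
    of phi xi; it moves an atom to an atom, hence lies in the range of phi. *)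
Lemma convolution_periods (mu nu : probability T R)
    (phi psi h : {additive T -> T}) :
  injective phi ->
  (forall z, mu (psi @^-1` [set z]) =
     \esum_(y in setT) (nu [set y] * mu [set x | phi x + h y = z]%R)) ->
  forall t, difference_group nu t ->
    exists2 e, translation_period mu e & h t = phi e.
Proof.
move=> phi_inj lawE.
have tr := convolution_translates phi_inj lawE.
have phi1 x : phi @^-1` [set phi x] = [set x].
  by apply/seteqP; split => [y /= /phi_inj //|y /= ->].
apply: generated_subgroup_ind => [|_ [y nu_y [y' nu_y' <-]]].
  exact/subgroup_image_preimage/translation_period_subgroup.
have inv x : mu (phi @^-1` [set phi x + h (y - y')]%R) = mu [set x].
  rewrite raddfB addrA tr // -(tr y (phi x + h y)%R) //.
  by rewrite addrK phi1.
have [x0 x0_gt0] := atoms_nonempty mu.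
have [|x1 _ /= x1E] := @atomsP mu (phi @^-1` [set phi x0 + h (y - y')]%R).
  by rewrite inv.
have hE : h (y - y')%R = phi (x1 - x0)%R.
  by rewrite [RHS]raddfB x1E addrAC subrr add0r.
exists (x1 - x0)%R => // x.
by rewrite -(inv x) hE -raddfD phi1.
Qed.

(** The supports of psi xi and phi xi are translates of each other, so they have
    the same differences. *)
Lemma convolution_difference_group (mu nu : probability T R)
    (phi psi h : {additive T -> T}) :
  injective phi ->
  (forall z, mu (psi @^-1` [set z]) =
     \esum_(y in setT) (nu [set y] * mu [set x | phi x + h y = z]%R)) ->
  forall x, difference_group mu x ->
    exists2 y, difference_group mu y & psi x = phi y.
Proof.
move=> phi_inj lawE.
have tr := convolution_translates phi_inj lawE.
have [y nu_y] := atoms_nonempty nu.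
have shift s : atoms mu s -> exists2 s', atoms mu s' & (psi s - h y = phi s')%R.
  move=> mu_s.
  have [|s' mu_s' /= s'E] := @atomsP mu (phi @^-1` [set psi s - h y]%R).
    by rewrite tr //; exact: atoms_gt0 mu_s _.
  by exists s'.
apply: generated_subgroup_ind => [|_ [s mu_s [t mu_t <-]]].
  exact/subgroup_image_preimage/generated_is_subgroup.
have [s' mu_s' s'E] := shift s mu_s; have [t' mu_t' t'E] := shift t mu_t.
exists (s' - t')%R.
  by move=> H [_]; apply; exists s' => //; exists t'.
by rewrite [RHS]raddfB -s'E -t'E raddfB opprB addrA subrK.
Qed.

End discrete_laws.

(** * Splitting off a Haar factor *)

Section decomposition.
Context (X : countZmodType) (R : realType).
Local Notation T := (discrete X).
Local Open Scope ereal_scope.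
Implicit Types mu nu rho m : probability T R.

(** A copy of [f] to carry its measurability structure, as every map out of
    a discrete group is measurable. *)
Definition discrete_map (f : T -> T) : T -> T := f.

Lemma measurable_discrete_map f : measurable_fun [set: T] (discrete_map f).
Proof. by []. Qed.

HB.instance Definition _ f :=
  isMeasurableFun.Build _ _ _ _ (discrete_map f) (measurable_discrete_map f).

Lemma image_law mu (f : T -> T) :
  exists rho, forall A, rho A = mu (f @^-1` A).
Proof. by exists (distribution mu (discrete_map f)). Qed.

Lemma atoms_full mu (A : set T) : atoms mu `<=` A -> mu A = 1.
Proof.
move=> muA; rewrite -(law_esum1 mu) law_esum; apply: eq_esum => x _.
case: ifPn => // /negP xA; apply/esym/not_atom => /muA Ax.
by apply: xA; exact/mem_set.
Qed.

Lemma atoms_sub mu (A : set T) : mu A = 1 -> atoms mu `<=` A.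
Proof.
move=> muA x mu_x; apply: contrapT => nAx.
have : mu (~` A) = 0.
  by rewrite probability_setC // muA subee.
by move=> A0; have := @atoms_gt0 X R mu (~` A) x mu_x nAx; rewrite A0 ltxx.
Qed.

Lemma translation_periodP mu e (A : set T) :
  translation_period mu e -> mu [set x | A (x + e)%R] = mu A.
Proof.
move=> pe; rewrite law_esum [RHS]law_esum.
rewrite -[RHS](esum_shift _ (- e)%R); apply: eq_esum => x _; rewrite opprK pe.
by congr (if _ then _ else _); apply/idP/idP => /set_mem Ax; exact/mem_set.
Qed.

Lemma convolution_esuml mu nu (A : set T) : convolution mu nu A =
  \esum_(x in setT) (mu [set x] * nu [set y | A (x + y)%R]).
Proof.
rewrite /convolution /distribution /pushforward.
have mA : measurable (@addp X @^-1` A) by exact: measurable_funPTI.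
rewrite (measure_partition _ (@measurable_fst _ _ T T)) //.
apply: eq_esum => x _; rewrite -product_measure1E //; congr (_ _).
by apply/seteqP; split => -[s t] /= [] => [? <-|-> ?].
Qed.

Lemma convolution_esumr mu nu (A : set T) : convolution mu nu A =
  \esum_(y in setT) (nu [set y] * mu [set x | A (x + y)%R]).
Proof.
rewrite /convolution /distribution /pushforward.
have mA : measurable (@addp X @^-1` A) by exact: measurable_funPTI.
rewrite (measure_partition _ (@measurable_snd _ _ T T)) //.
apply: eq_esum => y _; rewrite muleC -product_measure1E //; congr (_ _).
by apply/seteqP; split => -[s t] /= [] => [? <-|? ->].
Qed.

Lemma convolution_dirac nu x0 (A : set T) :
  convolution nu (dirac x0) A = nu [set x | A (x + x0)%R].
Proof.
rewrite convolution_esumr.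
transitivity (\esum_(y in setT)
    (if y \in [set x0] then nu [set x | A (x + y)%R] else 0)).
  apply: eq_esum => y _; rewrite /= diracE.
  have -> : (x0 \in [set y]) = (y \in [set x0]).
    by apply/idP/idP => /set_mem /= ->; exact/mem_set.
  by case: (y \in _); rewrite ?mul1e ?mul0e.
by rewrite -esum_mkcond esum_set1.
Qed.

(** Conditioned on its second term, an independent sum has as its law a
    translate of [mu] by a period. *)
Lemma convolution_period mu m (A : set T) :
  atoms m `<=` translation_period mu -> convolution mu m A = mu A.
Proof.
move=> mper; rewrite convolution_esumr.
transitivity (\esum_(y in setT) (fine (mu A))%:E * m [set y]).
  apply: eq_esum => y _; rewrite fineK ?fin_num_measure // muleC.
  have [/mper per|] := pselect (atoms m y).
    by rewrite (translation_periodP _ per).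
  by move=> /not_atom ->; rewrite !mule0.
by rewrite esumZl // ?law_esum1 ?mule1 ?fineK ?fin_num_measure // fine_ge0.
Qed.

(** By periodicity, [mu] is also the law of xi + kappa, where kappa has law [m]
    and is independent of xi. Write xi = f xi + g xi + x0: given xi, the
    variable g xi + kappa has law [m] because g xi lies in [K], so xi + kappa
    has the law of f xi + kappa + x0. *)
Lemma haar_decomposition mu rho m (K : set T) (x0 : T) (f g : T -> T) :
  is_haar_distribution K m -> K `<=` translation_period mu ->
  (forall A, rho A = mu (f @^-1` A)) ->
  (forall x, atoms mu x -> K (g x) /\ x = (f x + g x + x0)%R) ->
  mu = convolution (convolution rho m) (dirac x0) :> (set _ -> _).
Proof.
move=> [mK haar] Kper rhoE split_atom; apply/funext => A.
rewrite convolution_dirac /= convolution_esuml.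
rewrite -(@convolution_period mu m) ?convolution_esuml; last first.
  by move=> y /(atoms_sub mK)/Kper.
under [RHS]eq_esum do rewrite rhoE.
rewrite [RHS](@esum_image_law X R mu f (fun x => m [set y | A (x + y + x0)%R]))
  => // [|z]; last by rewrite fin_num_measure.
apply: eq_esum => x _.
have [/split_atom[Kg xE]|/not_atom ->] := pselect (atoms mu x); last first.
  by rewrite !mul0e.
congr (_ * _); rewrite -(haar _ _ Kg).
have key y : (x + y = f x + (g x + y) + x0)%R.
  by rewrite {1}xE [LHS]addrAC [in RHS]addrA.
congr (m _); apply/seteqP; split => [_ [y /= Ay <-]|y /= Ay].
  by rewrite /= -key.
exists (y - g x)%R => /=; last by rewrite addrC subrK.
by rewrite key [(g x + _)%R]addrC subrK.
Qed.

End decomposition.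

(** * From the symmetry of the linear forms to equalities in law *)

Section linear_forms.
Context d (Omega : measurableType d) (R : realType) (P : probability Omega R).
Context (X : countZmodType).
Local Notation T := (discrete X).
Local Open Scope ereal_scope.

Lemma measurable_joint (Y Z : {RV P >-> T}) (Q : T -> T -> Prop) :
  measurable [set w | Q (Y w) (Z w)].
Proof.
rewrite (_ : [set w | _] =
    \bigcup_z (Y @^-1` [set y | Q y z] `&` Z @^-1` [set z])).
  apply: countable_bigcupT_measurable; first exact: countableP.
  by move=> z; apply: measurableI; exact: measurable_funPTI.
apply/seteqP; split => [w Qw|w [z _ [/= Qz Zw]]]; first by exists (Z w).
by rewrite /= Zw.
Qed.

Lemma independent_joint (Y Z : {RV P >-> T}) (Q : T -> T -> Prop) :
  independent_RV Y Z ->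
  P [set w | Q (Y w) (Z w)] =
  \esum_(z in setT) (distribution P Z [set z] *
                     distribution P Y [set y | Q y z]).
Proof.
move=> ind; have mZ : measurable_fun setT Z by exact: measurable_funPT.
rewrite (measure_partition P mZ (measurable_joint Y Z Q)).
apply: eq_esum => z _; rewrite muleC -[RHS]ind //; congr (P _).
by apply/seteqP; split => w /= [Qw zE]; move: Qw; rewrite zE.
Qed.

(** Values that L1 takes with probability zero contribute nothing; given any
    other value, L2 and -L2 have the same law. *)
Lemma conditionally_symmetric_joint (L1 L2 : Omega -> T) (Q : T -> T -> Prop) :
  (forall A : T -> T -> Prop, measurable [set w | A (L1 w) (L2 w)]) ->
  conditionally_symmetric P L2 L1 ->
  P [set w | Q (L1 w) (L2 w)] = P [set w | Q (L1 w) (- L2 w)%R].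
Proof.
move=> mL sym.
have mL1 : measurable_fun setT L1.
  by move=> _ B _; rewrite setTI; exact: (mL (fun x _ => B x)).
have mQ : measurable [set w | Q (L1 w) (- L2 w)%R].
  exact: (mL (fun x y => Q x (- y)%R)).
rewrite (measure_partition P mL1 (mL Q)) (measure_partition P mL1 mQ).
apply: eq_esum => y _.
have -> : [set w | Q (L1 w) (L2 w)] `&` L1 @^-1` [set y] =
    L2 @^-1` [set z | Q y z] `&` L1 @^-1` [set y].
  by apply/seteqP; split => w /= [Qw zE]; move: Qw; rewrite zE.
have -> : [set w | Q (L1 w) (- L2 w)%R] `&` L1 @^-1` [set y] =
    (fun w => - L2 w)%R @^-1` [set z | Q y z] `&` L1 @^-1` [set y].
  by apply/seteqP; split => w /= [Qw zE]; move: Qw; rewrite zE.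
set A := [set z | Q y z].
have mA : measurable (L2 @^-1` A `&` L1 @^-1` [set y]).
  exact: (mL (fun x z => Q y z /\ x = y)).
have mA' : measurable ((fun w => - L2 w)%R @^-1` A `&` L1 @^-1` [set y]).
  exact: (mL (fun x z => Q y (- z)%R /\ x = y)).
have my : measurable (L1 @^-1` [set y]) by exact: (mL (fun x _ => x = y)).
have [y_gt0|] := boolP (0 < P (L1 @^-1` [set y])).
  have p_neq0 : (fine (P (L1 @^-1` [set y])) != 0)%R.
    by rewrite gt_eqF // -lte_fin fineK // fin_num_measure.
  have := congr1 (fun c => c A) (sym y y_gt0).
  rewrite /conditional_distribution => symA.
  have := congr1 EFin (divIf p_neq0 symA).
  by rewrite !fineK // fin_num_measure.
rewrite -leNgt => y_le0.
have null B : measurable (B `&` L1 @^-1` [set y]) ->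
    P (B `&` L1 @^-1` [set y]) = 0.
  move=> mB; apply/eqP; rewrite eq_le measure_ge0 andbT.
  apply: le_trans y_le0; apply: le_measure; [exact/mem_set|exact/mem_set|].
  exact: subIsetr.
by transitivity (0 : \bar R); [exact: null|exact/esym/null].
Qed.

End linear_forms.

Theorem theorem3 (R : realType) (d : measure_display)
    (Omega : measurableType d) (P : probability Omega R) (X : countZmodType)
    (alpha : {additive discrete X -> discrete X})
    (xi1 xi2 : {RV P >-> discrete X}) :
  bijective alpha ->
  [set x | x + alpha x = 0] = [set 0] ->
  independent_RV xi1 xi2 ->
  conditionally_symmetric P (fun w => xi1 w + alpha (xi2 w))
                            (fun w => xi1 w + xi2 w) ->
  exists (rho1 rho2 : probability (discrete X) R)
         (K : set (discrete X)) (mK : probability (discrete X) R)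
         (x1 x2 : discrete X),
    [/\ distr_support rho1 `<=` two_component (discrete X) /\
          distr_support rho2 `<=` two_component (discrete X),
        [/\ is_subgroup K, finite_set K & K `<=` odd_subgroup (discrete X)],
        is_haar_distribution K mK,
        distribution P xi1 =
          convolution (convolution rho1 mK) (dirac x1) :> (set _ -> _)
      & distribution P xi2 =
          convolution (convolution rho2 mK) (dirac x2) :> (set _ -> _)].
Proof.
move=> [alpha' alphaK alpha'K] ker0 ind sym.
set mu1 : probability (discrete X) R := distribution P xi1.
set mu2 : probability (discrete X) R := distribution P xi2.
pose phi : {additive discrete X -> discrete X} := idfun \+ alpha.
pose dbl : {additive discrete X -> discrete X} := idfun \+ idfun.
pose dbla : {additive discrete X -> discrete X} := alpha \+ alpha.
pose psi1 : {additive discrete X -> discrete X} := alpha \- idfun.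
pose psi2 : {additive discrete X -> discrete X} := idfun \- alpha.
have phi0 x : x + alpha x = 0 -> x = 0.
  by move=> x0; have : [set x | x + alpha x = 0] x by []; rewrite ker0.
have phi_inj : injective phi.
  move=> x y; rewrite /phi /= => xy; apply/eqP; rewrite -subr_eq0; apply/eqP.
  by apply: phi0; rewrite raddfB addrACA -opprD xy subrr.
have ind' : independent_RV xi2 xi1.
  by move=> A B mA mB; rewrite setIC muleC; exact: ind.
have symQ Q : P [set w | Q (xi1 w + xi2 w) (xi1 w + alpha (xi2 w))] =
    P [set w | Q (xi1 w + xi2 w) (- (xi1 w + alpha (xi2 w)))].
  apply: (conditionally_symmetric_joint (L1 := fun w => xi1 w + xi2 w)
    (L2 := fun w => xi1 w + alpha (xi2 w))) => // A.
  exact: (measurable_joint xi1 xi2 (fun x y => A (x + y) (x + alpha y))).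
(* alpha L1 - L2 = alpha xi1 - xi1 and alpha L1 + L2 = phi xi1 + 2 alpha xi2. *)
have law1 z : mu1 (psi1 @^-1` [set z]) =
    (\esum_(y in setT) (mu2 [set y] * mu1 [set x | phi x + dbla y = z]%R))%E.
  rewrite -(independent_joint (fun x y => phi x + dbla y = z)%R ind).
  transitivity
    (P [set w | alpha (xi1 w + xi2 w) - (xi1 w + alpha (xi2 w)) = z]).
    congr (P _); apply/funext => w; congr (_ = z).
    by rewrite /psi1 /= raddfD opprD addrACA subrr addr0.
  rewrite (symQ (fun s t => alpha s - t = z)).
  congr (P _); apply/funext => w; congr (_ = z).
  by rewrite /phi /dbla /= raddfD opprK addrACA [alpha _ + xi1 w]addrC.
(* L1 - L2 = xi2 - alpha xi2 and L1 + L2 = phi xi2 + 2 xi1. *)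
have law2 z : mu2 (psi2 @^-1` [set z]) =
    (\esum_(y in setT) (mu1 [set y] * mu2 [set x | phi x + dbl y = z]%R))%E.
  rewrite -(independent_joint (fun x y => phi x + dbl y = z)%R ind').
  transitivity (P [set w | (xi1 w + xi2 w) - (xi1 w + alpha (xi2 w)) = z]).
    congr (P _); apply/funext => w; congr (_ = z).
    by rewrite /psi2 /= opprD addrACA subrr add0r.
  rewrite (symQ (fun s t => s - t = z)).
  congr (P _); apply/funext => w; congr (_ = z).
  by rewrite /phi /dbl /= opprK addrACA addrC.
have [x1 mu1_x1] := atoms_nonempty mu1.
have [x2 mu2_x2] := atoms_nonempty mu2.
pose H1 := difference_group mu1; pose H2 := difference_group mu2.
have sH1 : is_subgroup H1 by exact: generated_is_subgroup.
have sH2 : is_subgroup H2 by exact: generated_is_subgroup.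
have [|||k [b [u [v [[odd_b b_u] split_H O12 O1 O2]]]]] :=
    @common_odd_part _ alpha alpha' H1 H2 (translation_period mu1)
      (translation_period mu2) alphaK alpha'K phi0 sH1 sH2
      (translation_period_subgroup mu1) (translation_period_subgroup mu2)
      (finite_translation_period mu1) (finite_translation_period mu2)
      (@translation_period_sub _ _ mu1) (@translation_period_sub _ _ mu2).
- move=> x /(convolution_periods phi_inj law1)[e pe xE]; exists e => //.
  by rewrite mulr2n raddfD.
- by move=> x /(convolution_periods phi_inj law2)[e pe xE]; exists e.
- move=> x H1x.
  have [y H1y yE] := convolution_difference_group phi_inj law1 H1x.
  (* 2 x = phi x - psi1 x, and psi1 x = phi y. *)
  exists (x - y); first exact: (subgroupB sH1 H1x H1y).
  rewrite -[RHS]/(phi (x - y)) raddfB -yE /phi /psi1 /= opprB.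
  by rewrite addrACA subrr addr0 mulr2n.
set K := torsion_part b H1 in O1 O2 O12.
have sK : is_subgroup K by exact: torsion_part_subgroup.
have diff1 x : atoms mu1 x -> H1 (x - x1).
  by move=> mu_x H [_]; apply; exists x => //; exists x1.
have diff2 x : atoms mu2 x -> H2 (x - x2).
  by move=> mu_x H [_]; apply; exists x => //; exists x2.
have splitK1 x : atoms mu1 x -> K ((x - x1) *+ v) /\
    x = (x - x1) *+ u + (x - x1) *+ v + x1.
  move=> /diff1 Hx; have [_ xvb <-] := split_H _ (or_introl Hx).
  by rewrite subrK; split => //; split => //; exact: subgroupMn sH1 Hx.
have splitK2 x : atoms mu2 x -> K ((x - x2) *+ v) /\
    x = (x - x2) *+ u + (x - x2) *+ v + x2.
  move=> /diff2 Hx; have [_ xvb <-] := split_H _ (or_intror Hx).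
  by rewrite subrK O12; split => //; split => //; exact: subgroupMn sH2 Hx.
have [rho1 rho1E] := image_law mu1 (fun x => (x - x1) *+ u).
have [rho2 rho2E] := image_law mu2 (fun x => (x - x2) *+ u).
(* The odd component of xi1 is uniform on K because the law of xi1 is
   K-periodic; this supplies the Haar distribution. *)
have [mK mKE] := image_law mu1 (fun x => (x - x1) *+ v).
have haarK : is_haar_distribution K mK.
  split; first by rewrite mKE; apply: atoms_full => x /splitK1[].
  move=> e A Ke; rewrite !mKE.
  have ev : e *+ v = e.
    have [_ _ eE] := split_H e (or_introl Ke.1); rewrite [RHS]eE.
    have /dvdnP[s ->] := b_u.
    by rewrite mulnC mulrnA Ke.2 mul0rn add0r.
  rewrite -(translation_periodP _ (O1 e Ke)); congr (mu1 _).
  apply/seteqP; split => x /=.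
    move=> [a Aa aE]; suff <- : a = (x - x1) *+ v by [].
    by apply: (addrI e); rewrite aE addrAC mulrnDl ev [RHS]addrC.
  move=> Ax; exists ((x - x1) *+ v) => //.
  by rewrite [x + e - x1]addrAC [RHS]mulrnDl ev [LHS]addrC.
have supp (mu rho : probability (discrete X) R) x0 :
    (forall A, rho A = mu ((fun x => (x - x0) *+ u) @^-1` A)) ->
    (forall x, atoms mu x -> H1 (x - x0) \/ H2 (x - x0)) ->
    distr_support rho `<=` two_component (discrete X).
  move=> rhoE diff x supp_x.
  have : (0 < rho [set x])%E by apply: supp_x; exact/principal_filterP.
  rewrite rhoE => /atomsP[y /diff Hy /= <-].
  by have [yk _ _] := split_H _ Hy; exact: two_componentP yk.
exists rho1, rho2, K, mK, x1, x2; split => //.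
- split; [apply: (supp mu1 rho1 x1 rho1E) | apply: (supp mu2 rho2 x2 rho2E)].
    by move=> x /diff1; left.
  by move=> x /diff2; right.
- split => //; first exact: sub_finite_set (finite_translation_period mu1).
  by move=> x [_ xb]; exact: odd_subgroupP odd_b xb.
- exact: haar_decomposition haarK O1 rho1E splitK1.
- exact: haar_decomposition haarK O2 rho2E splitK2.
Qed.
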